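(* Let $\mathcal{J}$ be a finite dimensional semisimple Jordan algebra over an algebraically closed field of characteristic different from $2$. Then every 2-local 1-automorphism on $\mathcal{J}$ is an automorphism.
   Context: $\mathcal{J}$ is unital with identity $1$. A symmetry is $s\in\mathcal{J}$ with $s^2=1$, and $U_s(x)=2s(sx)-x$. A 2-local 1-automorphism is a map $\Delta:\mathcal{J}\to\mathcal{J}$ (not assumed linear) such that for every $x,y\in\mathcal{J}$ there is a symmetry $s$ with $\Delta(x)=U_s(x)$ and $\Delta(y)=U_s(y)$. *)

(* Defs.v *)
From HB Require Import structures.
From mathcomp Require Import all_boot all_order all_algebra.
Set Implicit Arguments. Unset Strict Implicit. Unset Printing Implicit Defensive.
Import GRing.Theory.
Local Open Scope ring_scope.

Definition bilinear_mul (F : fieldType) (V : vectType F) (mul : V -> V -> V) :=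
  (forall (a : F) (x y z : V), mul (a *: x + y) z = a *: mul x z + mul y z) /\
  (forall (a : F) (x y z : V), mul z (a *: x + y) = a *: mul z x + mul z y).

Definition is_jordan_algebra (F : fieldType) (V : vectType F) (mul : V -> V -> V) :=
  [/\ bilinear_mul mul,
      (forall x y, mul x y = mul y x) &
      (forall x y, mul (mul x y) (mul x x) = mul x (mul y (mul x x)))].

Definition is_unit_elt (F : fieldType) (V : vectType F) (mul : V -> V -> V) (one : V) :=
  forall x, mul one x = x /\ mul x one = x.

(* powers x^1 = x, x^(n+2) = x * x^(n+1) (Jordan algebras are power associative) *)
Fixpoint jpow (F : fieldType) (V : vectType F) (mul : V -> V -> V) (x : V) (n : nat) : V :=
  match n with
  | 0%N => x
  | n'.+1 => mul x (jpow mul x n')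
  end.

Definition jnilpotent (F : fieldType) (V : vectType F) (mul : V -> V -> V) (x : V) :=
  exists n, jpow mul x n = 0.

Definition is_ideal (F : fieldType) (V : vectType F) (mul : V -> V -> V) (I : {vspace V}) :=
  forall x y, y \in I -> (mul x y \in I) && (mul y x \in I).

(* semisimple: the (nil) radical is zero, i.e. there is no nonzero ideal
   consisting of nilpotent elements *)
Definition jsemisimple (F : fieldType) (V : vectType F) (mul : V -> V -> V) :=
  forall I : {vspace V}, is_ideal mul I ->
    (forall x, x \in I -> jnilpotent mul x) -> I = 0%VS.

Definition is_symmetry (F : fieldType) (V : vectType F) (mul : V -> V -> V) (one s : V) :=
  mul s s = one.

Definition Umap (F : fieldType) (V : vectType F) (mul : V -> V -> V) (s x : V) : V :=
  (mul s (mul s x)) *+ 2 - x.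

Definition two_local_1_automorphism (F : fieldType) (V : vectType F)
    (mul : V -> V -> V) (one : V) (D : V -> V) :=
  forall x y : V, exists s : V,
    [/\ is_symmetry mul one s, D x = Umap mul s x & D y = Umap mul s y].

Definition is_automorphism (F : fieldType) (V : vectType F) (mul : V -> V -> V) (D : V -> V) :=
  [/\ (forall (a : F) (x y : V), D (a *: x + y) = a *: D x + D y),
      bijective D &
      (forall x y, D (mul x y) = mul (D x) (D y))].

(* Main.v *)
Require Import Defs.
From HB Require Import structures.
From mathcomp Require Import all_boot all_order all_algebra.
From mathcomp Require Import ring.
From Stdlib Require Import Classical ClassicalEpsilon.
Set Implicit Arguments. Unset Strict Implicit. Unset Printing Implicit Defensive.
Import GRing.Theory.
Local Open Scope ring_scope.

(* Write U_a for the quadratic map of a Jordan algebra, so that the hypothesis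
   on D reads D x = U_s x, D y = U_s y with s^2 = 1.  For w in V let Z_w be the
   set of x such that U_w U_x is nilpotent, and consider the linear functionals
   f with f 1 = 1 and kernel Z_w for some w.  By the fundamental formula
   U_(U_a b) = U_a U_b U_a, x lies in Z_(U_a w) iff U_a x lies in Z_w.  Hence

   - f o U_a is, up to a scalar, again such a functional whenever
     f (a^2) <> 0; taking a = 1 + t u and comparing terms in t, the common
     kernel K of these functionals is an ideal;
   - each f satisfies f = g o D for another such functional g: choose s for the
     pair (w, x); since g is determined by D w, it does not depend on x.

   If K were not nil it would contain a primitive idempotent e.  Every element
   of the Peirce space U_e V is a scalar plus a nilpotent, and the scalar part
   composed with U_e is one of the functionals above, with value 1 at e, which
   contradicts e in K.  So K is a nil ideal, and K = 0 by semisimplicity: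
   finitely many of the f separate points, so do the corresponding g by a dimension count,
   and g o D = f forces D to be linear.  Finally D (x^2) = (D x)^2 by the choice
   of s for the pair (x^2, x).

   A trace form would give a shorter argument in characteristic 0, but
   tr L_(xy) may degenerate in characteristic p. *)

(** * Linear identities between vectors *)

Section VectorIdentities.
Variables (F : fieldType) (V : vectType F).

Lemma add_self_inj (x y : V) : (2%:R : F) != 0 ->
  x + x = y + y -> x = y.
Proof.
move=> char2 /eqP; rewrite -!mulr2n -!scaler_nat -subr_eq0 -scalerBr scaler_eq0.
by rewrite (negPf char2) subr_eq0 => /eqP.
Qed.

Lemma sub_eq_trans (l r x y : V) : l = r -> x - y = r - l -> x = y.
Proof. by move=> ->; rewrite subrr => /subr0_eq. Qed.

(* Linear identities between vectors are checked on scalars, where [ring]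
   applies. *)
Lemma functional_ext (x y : V) :
  (forall f : V -> F, (forall u v, f (u + v) = f u + f v) ->
     (forall u, f (- u) = - f u) -> (forall a u, f (a *: u) = a * f u) -> f 0 = 0 ->
     f x = f y) -> x = y.
Proof.
move=> h; rewrite (coord_vbasis (memvf x)) (coord_vbasis (memvf y)).
apply: eq_bigr => i _; congr (_ *: _); apply: h => *; first exact: linearD.
- exact: linearN.
- exact: linearZ.
- exact: linear0.
Qed.

End VectorIdentities.

Ltac vring := rewrite ?mulr2n; apply: functional_ext;
  let fD := fresh in let fN := fresh in let fZ := fresh in let f0 := fresh in
  intros ? fD fN fZ f0; rewrite ?(fD, fN, fZ, f0); ring.

(** * Jordan identities and the fundamental formula *)

Section Jordan.
Variables (F : fieldType) (V : vectType F) (mul : V -> V -> V).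
Hypotheses (char2 : (2%:R : F) != 0) (hJ : is_jordan_algebra mul).

Local Notation "x ∙ y" := (mul x y) (at level 40, left associativity).

Lemma jmulC x y : x ∙ y = y ∙ x.
Proof. by case: hJ. Qed.

Lemma jmulDl x y z : (x + y) ∙ z = x ∙ z + y ∙ z.
Proof. by case: hJ => [[h _] _ _]; have := h 1 x y z; rewrite !scale1r. Qed.

Lemma jmulDr x y z : z ∙ (x + y) = z ∙ x + z ∙ y.
Proof. by rewrite !(jmulC z) jmulDl. Qed.

Lemma jmul0l x : 0 ∙ x = 0.
Proof. by apply: (addrI (0 ∙ x)); rewrite -jmulDl !addr0. Qed.

Lemma jmul0r x : x ∙ 0 = 0.
Proof. by rewrite jmulC jmul0l. Qed.

Lemma jmulZl a x y : (a *: x) ∙ y = a *: (x ∙ y).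
Proof. by case: hJ => [[h _] _ _]; rewrite -[a *: x]addr0 h jmul0l addr0. Qed.

Lemma jmulZr a x y : x ∙ (a *: y) = a *: (x ∙ y).
Proof. by rewrite !(jmulC x) jmulZl. Qed.

Lemma jmulNl x y : (- x) ∙ y = - (x ∙ y).
Proof. by rewrite -scaleN1r jmulZl scaleN1r. Qed.

Lemma jmulNr x y : x ∙ (- y) = - (x ∙ y).
Proof. by rewrite !(jmulC x) jmulNl. Qed.

Definition jmulE := (jmulDl, jmulDr, jmulNl, jmulNr, jmulZl, jmulZr).

Lemma polarized_jordan x y z w :
  (x ∙ y) ∙ (z ∙ w) + (y ∙ z) ∙ (x ∙ w) + (z ∙ x) ∙ (y ∙ w) =
  z ∙ ((x ∙ y) ∙ w) + x ∙ ((y ∙ z) ∙ w) + y ∙ ((z ∙ x) ∙ w).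
Proof.
pose G u := (u ∙ u) ∙ (u ∙ w) - u ∙ ((u ∙ u) ∙ w).
have G0 u : G u = 0.
  case: hJ => _ _ h; apply/eqP; rewrite subr_eq0 (jmulC (u ∙ u)) h.
  by rewrite (jmulC w).
apply: (add_self_inj char2); apply: subr0_eq.
(* The part of the cubic map [G] that is linear in each of x, y, z; by commutativity it is twice the
   wanted identity. *)
have <- : G (x + y + z) - G (x + y) - G (x + z) - G (y + z) + G x + G y + G z
  = 0 by rewrite !G0 !subr0 !addr0.
rewrite /G !jmulE (jmulC y x) (jmulC z y) (jmulC z x); vring.
Qed.

(** [polarized_jordan] with w in the third place: multiplication by (xy)z becomes a sum of words in
    multiplications by shorter products. *)
Lemma mul_mul_operator x y z w :
  ((x ∙ y) ∙ z) ∙ w = (x ∙ y) ∙ (z ∙ w) + (y ∙ z) ∙ (x ∙ w) + (z ∙ x) ∙ (y ∙ w)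
     - x ∙ (z ∙ (y ∙ w)) - y ∙ (z ∙ (x ∙ w)).
Proof.
have := polarized_jordan x y w z.
rewrite (jmulC w z) (jmulC _ z) (jmulC (_ ∙ w) z) (jmulC _ w).
rewrite (jmulC z x) (jmulC y w) (jmulC (y ∙ z)) (jmulC x w) (jmulC (w ∙ x) z).
rewrite (jmulC (w ∙ y)) => /eqP; rewrite -subr_eq0 => /eqP E.
rewrite (jmulC (x ∙ y ∙ z)); apply: subr0_eq; rewrite -[RHS]oppr0 -E; vring.
Qed.

(* [tri x y z] is the Jordan triple product {x y z}, [quad x] the operator U_x. *)
Definition tri x y z := (x ∙ y) ∙ z + x ∙ (y ∙ z) - y ∙ (x ∙ z).
Definition quad x y := (x ∙ (x ∙ y)) *+ 2 - (x ∙ x) ∙ y.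

Lemma triDl x x' y z : tri (x + x') y z = tri x y z + tri x' y z.
Proof. rewrite /tri !jmulE; vring. Qed.
Lemma triDm x y y' z : tri x (y + y') z = tri x y z + tri x y' z.
Proof. rewrite /tri !jmulE; vring. Qed.
Lemma triDr x y z z' : tri x y (z + z') = tri x y z + tri x y z'.
Proof. rewrite /tri !jmulE; vring. Qed.
Lemma triNl x y z : tri (- x) y z = - tri x y z.
Proof. rewrite /tri !jmulE; vring. Qed.
Lemma triNm x y z : tri x (- y) z = - tri x y z.
Proof. rewrite /tri !jmulE; vring. Qed.
Lemma triNr x y z : tri x y (- z) = - tri x y z.
Proof. rewrite /tri !jmulE; vring. Qed.

Lemma triC x y z : tri x y z = tri z y x.
Proof.
rewrite /tri (jmulC (x ∙ y)) (jmulC z y) (jmulC x (y ∙ z)) (jmulC z x) (jmulC x y).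
vring.
Qed.

Lemma quad_tri x y : quad x y = tri x y x.
Proof. rewrite /quad /tri (jmulC (x ∙ y)) (jmulC y x) (jmulC y (x ∙ x)); vring. Qed.

Lemma mul_tri a u v z :
  a ∙ tri u v z = tri (a ∙ u) v z - tri u (a ∙ v) z + tri u v (a ∙ z).
Proof.
have E1 := polarized_jordan u v a z.
have E2 := mul_mul_operator u a v z.
have E3 := mul_mul_operator v a u z.
rewrite /tri (jmulC u (a ∙ v)) (jmulC a u) (jmulC a v) in E1 E2 E3 *.
rewrite E2 E3 (jmulC v u); apply: subr0_eq; move/eqP: E1; rewrite -subr_eq0 => /eqP E1.
rewrite -{}[RHS]oppr0 -{}E1 !jmulE; vring.
Qed.

(** As an operator, [tri x y] is L_(xy) + [L_x, L_y]. By [mul_tri] each L_a is a derivation of the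
    triple product up to a sign in the middle slot, and commutators lose that sign; the middle slot
    thus receives minus [tri y x]. *)
Lemma five_linear x y u v z :
  tri x y (tri u v z) =
  tri (tri x y u) v z - tri u (tri y x v) z + tri u v (tri x y z).
Proof.
have D a b c : tri a b c = (a ∙ b) ∙ c + a ∙ (b ∙ c) - b ∙ (a ∙ c) by [].
rewrite [LHS]D !(mul_tri, jmulE).
rewrite (D x y u) (D y x v) (D x y z) (jmulC y x) !(triDl, triDm, triDr, triNl, triNm, triNr).
vring.
Qed.

(* [five_linear] alone gives three times this identity, which is void in
   characteristic 3.  With L_a the multiplication by a, instances of the Jordan
   identity give [L_xy, L_xx] = 2 [L_(x(xy)), L_x] (R1), an expansion of
   L_(x(xy)) (R2), 2 [L_xy, L_x] = [L_y, L_xx] (R3) and [L_xx, L_x] = 0 (R4);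
   what remains cancels by the Jacobi identity for L_x, L_y, L_xx. *)
Lemma tri_quad x y v : tri x y (quad x v) = quad x (tri y x v).
Proof.
pose R1 w := (x ∙ y) ∙ ((x ∙ x) ∙ w) - (x ∙ x) ∙ ((x ∙ y) ∙ w)
  - ((x ∙ (x ∙ y)) ∙ (x ∙ w)) *+ 2 + (x ∙ ((x ∙ (x ∙ y)) ∙ w)) *+ 2.
pose R2 w := (x ∙ (x ∙ y)) ∙ w - (((x ∙ y) ∙ (x ∙ w)) *+ 2
  + (x ∙ x) ∙ (y ∙ w) - x ∙ (x ∙ (y ∙ w)) - y ∙ (x ∙ (x ∙ w))).
pose R3 w := y ∙ ((x ∙ x) ∙ w) - (x ∙ x) ∙ (y ∙ w)
  + (x ∙ ((x ∙ y) ∙ w)) *+ 2 - ((x ∙ y) ∙ (x ∙ w)) *+ 2.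
pose R4 w := (x ∙ x) ∙ (x ∙ w) - x ∙ ((x ∙ x) ∙ w).
have R1_0 w : R1 w = 0.
  have := polarized_jordan x x (x ∙ y) w; rewrite (jmulC (x ∙ y) x).
  move/eqP; rewrite -subr_eq0 => /eqP E; rewrite -[RHS]oppr0 -E /R1; vring.
have R2_0 w : R2 w = 0.
  have := mul_mul_operator x y x w; rewrite (jmulC y x) (jmulC (x ∙ y)).
  move/eqP; rewrite -subr_eq0 => /eqP <-; rewrite /R2; vring.
have R3_0 w : R3 w = 0.
  have := polarized_jordan x x y w; rewrite (jmulC y x).
  move/eqP; rewrite -subr_eq0 => /eqP E; rewrite -[RHS]oppr0 -E /R3; vring.
have R4_0 w : R4 w = 0.
  by case: hJ => _ _ h; rewrite /R4 (jmulC (x ∙ x)) h (jmulC w) subrr.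
apply: subr0_eq.
have -> : tri x y (quad x v) - quad x (tri y x v) =
  - R1 v - (R2 (x ∙ v)) *+ 2 + (x ∙ R2 v) *+ 2 - x ∙ R3 v + R3 (x ∙ v)
  - y ∙ R4 v - R4 (y ∙ v).
  rewrite /tri /quad /R1 /R2 /R3 /R4 !mulr2n !jmulE (jmulC y x); vring.
by rewrite !(R1_0, R2_0, R3_0, R4_0) !jmul0r !mul0rn !oppr0 !addr0.
Qed.

Lemma quadD x y z : quad x (y + z) = quad x y + quad x z.
Proof. by rewrite !quad_tri triDm. Qed.

Lemma quadN x y : quad x (- y) = - quad x y.
Proof. by rewrite !quad_tri triNm. Qed.

Lemma tri_quadr x y w : tri x w (quad x y) = quad x (tri y x w).
Proof.
have := five_linear x y x w x; rewrite -!quad_tri tri_quad (triC (quad x y)).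
by move=> E; apply: (add_self_inj char2); apply: (sub_eq_trans E); vring.
Qed.

(** The fundamental formula: [five_linear] expands {u z u} with u = U_x y ([E1]) and {(U_y x) x z}
    ([E2]); the terms in {y x t} cancel. *)
Lemma quad_quad x y z : quad (quad x y) z = quad x (quad y (quad x z)).
Proof.
set u := quad x y; set t := tri y x z.
have E1 : quad u z = quad x (tri y x t) + quad x (tri y x t)
                     - quad x (tri (quad y x) x z).
  have := five_linear x y x z u.
  have -> : tri x y u = quad x (quad y x) by rewrite tri_quad -quad_tri.
  rewrite !tri_quadr -!quad_tri -/u -/t (triC t) => E.
  by apply: (sub_eq_trans E); vring.
have E2 : tri (quad y x) x z = tri y x t + tri y x t - quad y (quad x z).
  have := five_linear z x y x y; rewrite -!quad_tri (triC z x (quad y x)).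
  rewrite (triC z x y) -/t (triC t) => ->; vring.
by rewrite E1 E2; move: (tri _ _ t) (quad y _) => a b; rewrite !quadD quadN; vring.
Qed.
End Jordan.

Lemma linear_inj_surj (F : fieldType) (V : vectType F) (g : V -> V) :
  linear g -> injective g -> forall y, exists x, g x = y.
Proof.
move=> glin ginj y.
pose G : {linear V -> V} := HB.pack g (GRing.isLinear.Build _ _ _ _ g glin).
have /eqP k0 : lker (linfun G) == 0%VS.
  by apply/lker0P => a b; rewrite !lfunE; apply: ginj.
have /memv_imgP [x _ E] : y \in limg (linfun G).
  suff -> : limg (linfun G) = fullv by exact: memvf.
  apply/eqP; rewrite eqEdim subvf /= -(limg_ker_dim (linfun G) fullv).
  by rewrite k0 capv0 dimv0 add0n.
by exists x; rewrite E lfunE.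
Qed.

Lemma linear_functionalP (F : fieldType) (V : vectType F) (g : V -> F) :
  (forall a x y, g (a *: x + y) = a * g x + g y) ->
  exists f : 'Hom(V, F^o), f =1 g.
Proof.
move=> glin.
pose G : {linear V -> F^o} := HB.pack g (GRing.isLinear.Build _ _ _ _ (g : V -> F^o) glin).
by exists (linfun G) => x; rewrite lfunE.
Qed.

(** * Power associativity *)

Section Powers.
Variables (F : fieldType) (V : vectType F) (mul : V -> V -> V) (one : V).
Hypotheses (char2 : (2%:R : F) != 0) (hJ : is_jordan_algebra mul).
Hypothesis hone : is_unit_elt mul one.

Local Notation "x ∙ y" := (mul x y) (at level 40, left associativity).
Local Notation U := (quad mul).
Local Notation mulE := (jmulE hJ).

Lemma jmul1l x : one ∙ x = x. Proof. by case: (hone x). Qed.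
Lemma jmul1r x : x ∙ one = x. Proof. by case: (hone x). Qed.

Lemma quad_linear x : linear (U x).
Proof.
move=> a y z; rewrite (quadD hJ); congr (_ + _).
by rewrite /quad !(jmulZr hJ) scalerBr scalerMnr.
Qed.

Lemma quad0r x : U x 0 = 0.
Proof. by rewrite /quad !(jmul0r hJ) mul0rn subrr. Qed.

Lemma quad0l y : U 0 y = 0.
Proof. by rewrite /quad !(jmul0l hJ) mul0rn subrr. Qed.

Lemma quad1l y : U one y = y.
Proof. by rewrite /quad !jmul1l mulr2n addrK. Qed.

Lemma quad1r x : U x one = x ∙ x.
Proof. by rewrite /quad !jmul1r mulr2n addrK. Qed.

Definition pw x n := iter n (mul x) one.

(** Induction on two consecutive powers: [mul_mul_operator] writes L_(x^(n+2)) in terms of L_x,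
    L_(x^2), L_(x^n) and L_(x^(n+1)). *)
Lemma comm_pw x n w : x ∙ (pw x n ∙ w) = pw x n ∙ (x ∙ w).
Proof.
suff [] : (forall w, x ∙ (pw x n ∙ w) = pw x n ∙ (x ∙ w)) /\
   (forall w, x ∙ (pw x n.+1 ∙ w) = pw x n.+1 ∙ (x ∙ w)) by [].
elim: n {w} => [|n [cP cQ]].
  by split=> w; rewrite /= ?jmul1r ?jmul1l.
split=> // w; rewrite /=; move: (mul_mul_operator char2 hJ x (pw x n) x).
rewrite /= in cQ; rewrite (jmulC hJ (pw x n) x) (jmulC hJ (x ∙ _) x).
have cS v : x ∙ ((x ∙ x) ∙ v) = (x ∙ x) ∙ (x ∙ v).
  by case: hJ => _ _ h; rewrite !(jmulC hJ (x ∙ x)) h.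
move: (x ∙ x) (x ∙ pw x n) (pw x n) cS cP cQ => S Q P cS cP cQ E.
by rewrite !E !mulE !(cP, cQ, cS).
Qed.

(** Evaluation of polynomials at x; [evM] makes it multiplicative, so that questions about a single
    element become polynomial identities. *)
Definition ev x (p : {poly F}) := \sum_(i < size p) p`_i *: pw x i.

Lemma ev_wide n x (p : {poly F}) : (size p <= n)%N -> ev x p = \sum_(i < n) p`_i *: pw x i.
Proof.
move=> le_pn; rewrite /ev (big_ord_widen n (fun i => p`_i *: pw x i) le_pn).
rewrite big_mkcond; apply: eq_bigr => i _; case: ltnP => // h.
by rewrite nth_default ?scale0r.
Qed.

Lemma evD x p q : ev x (p + q) = ev x p + ev x q.
Proof.
pose n := maxn (size p) (size q).
rewrite !(@ev_wide n) ?leq_maxl ?leq_maxr ?size_polyD // -big_split /=.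
by apply: eq_bigr => i _; rewrite coefD scalerDl.
Qed.

Lemma evZ x a p : ev x (a *: p) = a *: ev x p.
Proof.
rewrite !(@ev_wide (size p)) ?size_scale_leq // scaler_sumr.
by apply: eq_bigr => i _; rewrite coefZ scalerA.
Qed.

Lemma ev0 x : ev x 0 = 0.
Proof. by rewrite /ev size_poly0 big_ord0. Qed.

Lemma evN x p : ev x (- p) = - ev x p.
Proof. by rewrite -scaleN1r evZ scaleN1r. Qed.

Lemma evC x c : ev x c%:P = c *: one.
Proof. by rewrite (@ev_wide 1) ?size_polyC_leq1 // big_ord1 coefC eqxx. Qed.

Lemma ev1 x : ev x 1 = one.
Proof. by rewrite -[1]/(1%:P) evC scale1r. Qed.

Lemma evMX x p : ev x (p * 'X) = x ∙ ev x p.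
Proof.
rewrite (@ev_wide (size p).+1); last first.
  by rewrite (leq_trans (size_polyMleq _ _)) // size_polyX addn2.
rewrite big_ord_recl coefMX eqxx scale0r add0r /ev.
rewrite (big_morph (mul x) (fun y z => jmulDr hJ y z x) (jmul0r hJ x)).
by apply: eq_bigr => i _; rewrite coefMX /= (jmulZr hJ).
Qed.

Lemma evX x : ev x 'X = x.
Proof. by rewrite -['X]mul1r evMX ev1 jmul1r. Qed.

Lemma comm_ev x p w : x ∙ (ev x p ∙ w) = ev x p ∙ (x ∙ w).
Proof.
rewrite /ev !(big_morph (mul^~ _) (fun y z => jmulDl hJ y z _) (jmul0l hJ _)).
rewrite (big_morph (mul x) (fun y z => jmulDr hJ y z x) (jmul0r hJ x)).
by apply: eq_bigr => i _; rewrite !mulE comm_pw.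
Qed.

Lemma evM x p q : ev x (p * q) = ev x p ∙ ev x q.
Proof.
elim/poly_ind: p => [|p c IH]; first by rewrite mul0r ev0 (jmul0l hJ).
rewrite mulrDl -mulrA -commr_polyX mulrA !evD !evMX IH mul_polyC evZ evC.
rewrite (jmulDl hJ) (jmulZl hJ) jmul1l; congr (_ + _).
by rewrite [RHS](jmulC hJ) -comm_ev (jmulC hJ (ev x p)).
Qed.

Lemma ev_exp x p n : ev x (p ^+ n) = pw (ev x p) n.
Proof. by elim: n => [|n IH]; rewrite ?ev1 // exprS evM IH. Qed.

Lemma evXn x n : ev x 'X^n = pw x n.
Proof. by rewrite ev_exp evX. Qed.

Lemma quad_ev x p q : U (ev x p) (ev x q) = ev x (p ^+ 2 * q).
Proof.
by rewrite /quad -!evM mulr2n -evN -!evD; congr ev; ring.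
Qed.

Definition nilop (g : V -> V) := exists n, forall y, iter n g y = 0.
Definition nilpow x := exists n, pw x n = 0.

Lemma quad_pwSS x n : U x (pw x n) = pw x n.+2.
Proof. by rewrite -!evXn -{1}(evX x) quad_ev -exprD. Qed.

(** Since x^(2n+2) = U_x x^(2n), the fundamental formula adds two factors U_x at a time. *)
Lemma quad_pw x n y : U (pw x n.*2) y = iter n.*2 (U x) y.
Proof.
elim: n y => [|n IH] y; first by rewrite quad1l.
rewrite doubleS -quad_pwSS (quad_quad char2 hJ) IH.
by rewrite [in RHS]iterS [in RHS]iterSr.
Qed.

Lemma iter_quad_one x n : iter n (U x) one = pw x n.*2.
Proof.
by elim: n => //= n ->; rewrite quad_pwSS.
Qed.

Lemma nilop_quad x : nilop (U x) <-> nilpow x.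
Proof.
split=> [[n h]|[n h]]; first by exists n.*2; rewrite -iter_quad_one.
exists n.*2 => y; rewrite -quad_pw -addnn -evXn exprD evM evXn h.
by rewrite (jmul0l hJ) quad0l.
Qed.
End Powers.

(** * Algebras without proper idempotents *)

Section Idempotents.
Variables (F : fieldType) (V : vectType F) (mul : V -> V -> V) (one : V).
Hypotheses (char2 : (2%:R : F) != 0) (hJ : is_jordan_algebra mul).
Hypothesis hone : is_unit_elt mul one.

Local Notation "x ∙ y" := (mul x y) (at level 40, left associativity).
Local Notation ev := (ev mul one).
Local Notation evM := (evM char2 hJ hone).

Lemma annihilator_exists x : exists2 p : {poly F}, p != 0 & ev x p = 0.
Proof.
(* One more coefficient than dim V, so evaluation at x has a kernel. *)
pose n := (\dim {:V}).+1.
pose g (v : 'rV[F]_n) := ev x (rVpoly v).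
have glin : linear g by move=> a u v; rewrite /g linearP evD evZ.
pose G : {linear 'rV[F]_n -> V} := HB.pack g (GRing.isLinear.Build _ _ _ _ g glin).
have k0 : lker (linfun G) != 0%VS.
  apply/eqP => k0; have := limg_ker_dim (linfun G) fullv.
  rewrite k0 capv0 dimv0 add0n dimvf /dim /= mul1n => E.
  by have := dimvS (subvf (limg (linfun G))); rewrite E ltnn.
exists (rVpoly (vpick (lker (linfun G)))).
  apply/eqP => E; move: k0; rewrite -vpick0 -(rVpolyK (vpick _)) E.
  by rewrite linear0 eqxx.
by have := memv_pick (lker (linfun G)); rewrite memv_ker lfunE => /eqP.
Qed.

(** If u p + v q = 1, then up - (up)^2 = u v p q vanishes at x, so up becomes idempotent there. *)
Lemma idempotent_split x p q : ev x (p * q) = 0 -> coprimep p q ->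
  exists u, let c := ev x (u * p) in
    [/\ c ∙ c = c, c = 0 -> ev x p = 0 & c = one -> ev x q = 0].
Proof.
move=> h0 /Bezout_eq1_coprimepP [[u v] /= E]; exists u.
have h0' r : ev x (r * (p * q)) = 0 by rewrite evM h0 (jmul0r hJ).
split=> [|hc|hc].
- rewrite -evM; apply/eqP; rewrite -subr_eq0 -evN -evD.
  rewrite (_ : _ - _ = (- u * v) * (p * q)) ?h0' //.
  by rewrite -[X in _ - X]mulr1 -E; ring.
- rewrite -[p]mul1r -E mulrDl evD evM hc (jmul0l hJ) add0r.
  by rewrite -mulrA (mulrC q) h0'.
- by have := h0' u; rewrite mulrA evM hc (jmul1l hone).
Qed.
End Idempotents.

(** Hensel lifting of the power series of (a + X)^(-1/2), one coefficient at a time. *)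
Lemma inverse_sqrt_poly (F : closedFieldType) (a : F) k :
  (2%:R : F) != 0 -> a != 0 ->
  exists q r : {poly F}, q ^+ 2 * (a%:P + 'X) = 1 + 'X^k * r.
Proof.
move=> char2 a0.
have [c Ec] : exists c : F, c ^+ 2 = a^-1.
  have [c] := @solve_monicpoly F 2 (nth 0 [:: a^-1; 0]) isT.
  by rewrite !big_ord_recl big_ord0 /= mul0r expr0 mulr1 !addr0; exists c.
(* Carrying q(0) = c along keeps the coefficient 2 c a of the next correction invertible. *)
suff : exists q r : {poly F}, q.[0] = c /\ q ^+ 2 * (a%:P + 'X) = 1 + 'X^(k.+1) * r.
  by case=> q [r [_ E]]; exists q, ('X * r); rewrite E mulrA -exprSr.
have c0 : c != 0 by apply: contra_eqN Ec => /eqP ->; rewrite expr0n /= eq_sym invr_eq0.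
elim: k => [|k [q [r [q0 E]]]].
  exists c%:P, (c ^+ 2)%:P; rewrite hornerC; split=> //.
  rewrite -polyC_exp mulrDr -polyCM Ec mulVf //; ring.
(* Chosen so that the new remainder has zero constant term: r(0) + 2 d c a = 0. *)
pose d := - r.[0] / (2%:R * c * a).
have [s Es] : exists s, r + (2%:R * d%:P * q * (a%:P + 'X)
    + d%:P ^+ 2 * 'X^(k.+1) * (a%:P + 'X)) = s * 'X.
  suff /factor_theorem [s] : root (r + (2%:R * d%:P * q * (a%:P + 'X)
    + d%:P ^+ 2 * 'X^(k.+1) * (a%:P + 'X))) 0.
    by rewrite polyC0 subr0; exists s.
  apply/rootP.
  rewrite !(hornerE, horner_exp) q0 /= expr0n /= mulr0 mul0r addr0 -[1 + 1]/(2%:R).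
  by field; rewrite char2 c0 a0.
exists (q + d%:P * 'X^(k.+1)), s; split.
  by rewrite !(hornerE, horner_exp) /= expr0n /= mulr0 addr0.
rewrite (exprSr 'X k.+1) -mulrA (mulrC 'X s) -Es [in RHS]mulrDr addrA -E; ring.
Qed.

Section LocalAlgebra.
Variables (F : closedFieldType) (V : vectType F) (mul : V -> V -> V) (one : V).
Hypotheses (char2 : (2%:R : F) != 0) (hJ : is_jordan_algebra mul).
Hypothesis hone : is_unit_elt mul one.
Hypotheses (one0 : one != 0)
  (hlocal : forall c, mul c c = c -> c = 0 \/ c = one).

Local Notation "x ∙ y" := (mul x y) (at level 40, left associativity).
Local Notation U := (quad mul).
Local Notation ev := (ev mul one).
Local Notation pw := (pw mul one).
Local Notation nilpow := (nilpow mul one).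
Local Notation evM := (evM char2 hJ hone).
Local Notation evX := (evX hJ hone).
Local Notation ev_exp := (ev_exp char2 hJ hone).

Lemma ev_subC x a : ev x ('X - a%:P) = x - a *: one.
Proof. by rewrite evD evN evX evC. Qed.

(** Split an annihilating polynomial as (X - a)^k q at a root a. The associated idempotent is 0, and
    then (x - a)^k = 0, or it is 1, and then q annihilates x and has smaller degree. *)
Lemma local_eigenvalue x : exists a, nilpow (x - a *: one).
Proof.
have [p p0 px] := annihilator_exists mul one x.
elim/ltn_ind: {p}(size p) {-2}p (erefl (size p)) p0 px => n IH p sz_p p0 px.
have [/size_poly1P [c c0 Ep]|/closed_rootP [a pa]] := boolP (size p == 1%N).
  move: px; rewrite Ep evC => /eqP; rewrite scaler_eq0.
  by rewrite (negPf c0) (negPf one0).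
have [k [q qa Ep]] := multiplicity_XsubC p a; rewrite p0 /= in qa.
have k0 : (0 < k)%N.
  by case: k Ep => // Ep; move: pa; rewrite Ep expr0 mulr1 (negPf qa).
have := px; rewrite Ep mulrC => px'.
have cop : coprimep (('X - a%:P) ^+ k) q.
  by rewrite coprimep_expl // coprimep_sym coprimep_XsubC.
have [u [/hlocal [c0|c1] hc0 hc1]] := idempotent_split char2 hJ hone px' cop.
  by exists a, k; rewrite -ev_subC -ev_exp hc0.
have q0 : q != 0 by apply/eqP => q0; move: p0; rewrite Ep q0 mul0r eqxx.
apply: (IH (size q)) (hc1 c1) => //.
rewrite -sz_p Ep size_Mmonic ?monic_exp ?monicXsubC //.
by rewrite size_exp_XsubC addnS /= -[X in (X < _)%N]addn0 ltn_add2l.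
Qed.

(** U_h U_x U_h = U_1 = id makes U_h bijective, hence U_x injective; [U h x = one] thus serves as
    invertibility of x. *)
Lemma quad_inj h x : U h x = one -> injective (U x).
Proof.
move=> E.
have id z : U h (U x (U h z)) = z.
  by rewrite -(quad_quad char2 hJ) E (quad1l hone).
have hinj : injective (U h) by apply: (can_inj (g := U h \o U x)) => z /=; rewrite id.
move=> y z.
have [y' <-] := linear_inj_surj (quad_linear hJ h) hinj y.
have [z' <-] := linear_inj_surj (quad_linear hJ h) hinj z.
by move=> /(congr1 (U h)); rewrite !id => ->.
Qed.

Lemma nilpow_not_inj x : nilpow x -> ~ injective (U x).
Proof.
move=> /(nilop_quad char2 hJ hone) [n h] xinj; case/eqP: one0.
by elim: n h => [h|n IH h]; [exact: (h one)|apply: IH => y; apply: xinj; rewrite (quad0r hJ) -(h y)].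
Qed.

(** Here x = a + n with n^k = 0, and an inverse square root of a + X modulo X^k can be evaluated at
    n. *)
Lemma inverse_sqrt x a : a != 0 -> nilpow (x - a *: one) -> exists h, U h x = one.
Proof.
move=> a0 [k hk]; have [q [r E]] := inverse_sqrt_poly k char2 a0.
pose n := x - a *: one; exists (ev n q).
have -> : x = ev n (a%:P + 'X) by rewrite evD evC evX /n addrC subrK.
rewrite (quad_ev char2 hJ hone) E evD evM (evXn char2 hJ hone) hk (jmul0l hJ) addr0.
by rewrite (ev1 mul one).
Qed.

Lemma nilpow_or_inv x : nilpow x \/ exists h, U h x = one.
Proof.
have [a ha] := local_eigenvalue x.
have [a0|a0] := eqVneq a 0; first by left; rewrite a0 scale0r subr0 in ha.
by right; apply: inverse_sqrt ha.
Qed.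

(** Otherwise U_(U_h z) = U_h U_z U_h is injective, and so is U_z because U_h is bijective. *)
Lemma nilpow_quad h z : injective (U h) -> nilpow z -> nilpow (U h z).
Proof.
move=> hinj nz; have [//|[g E]] := nilpow_or_inv (U h z).
case: (nilpow_not_inj nz) => a b.
have [a' <-] := linear_inj_surj (quad_linear hJ h) hinj a.
have [b' <-] := linear_inj_surj (quad_linear hJ h) hinj b.
move=> /(congr1 (U h)); rewrite -!(quad_quad char2 hJ).
by move=> /(quad_inj E) ->.
Qed.

(** As w = 1 - z, the coprime polynomials X^i and (1 - X)^j would both vanish at z. *)
Lemma nilpow_sum_not_one z w : nilpow z -> nilpow w -> z + w <> one.
Proof.
move=> [i hi] [j hj] E; have Ew : w = ev z (1 - 'X).
  by rewrite evD evN evX (ev1 mul one) -E addrC addKr.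
have cop : coprimep 'X^i ((1 - 'X) ^+ j : {poly F}).
  rewrite coprimep_expl // coprimep_expr //; apply/Bezout_eq1_coprimepP.
  by exists (1, 1) => /=; ring.
have /Bezout_eq1_coprimepP [[u v] /= E1] := cop.
case/eqP: one0; rewrite -(ev1 mul one z) -E1 evD !evM (evXn char2 hJ hone) hi.
by rewrite ev_exp -Ew hj !(jmul0r hJ) addr0.
Qed.

(* If z + w were not nilpotent, it would have an inverse square root h, and
   U_h z + U_h w = 1 with both summands nilpotent. *)
Lemma nilpowD z w : nilpow z -> nilpow w -> nilpow (z + w).
Proof.
move=> nz nw; have [//|[h E]] := nilpow_or_inv (z + w).
have hinj : injective (U h).
  apply: (can_inj (g := U h \o U (z + w))) => y /=.
  by rewrite -(quad_quad char2 hJ) E (quad1l hone).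
case: (@nilpow_sum_not_one (U h z) (U h w)); try exact: nilpow_quad.
by rewrite -(quadD hJ).
Qed.

Lemma nilpowZ a z : nilpow z -> nilpow (a *: z).
Proof.
move=> [k hk]; exists k.
have -> : a *: z = ev z (a *: 'X) by rewrite evZ evX.
by rewrite -ev_exp exprZn evZ (evXn char2 hJ hone) hk scaler0.
Qed.

Lemma nilpow_scale_one a : nilpow (a *: one) -> a = 0.
Proof.
move=> [k]; rewrite -(evC mul one 0) -ev_exp -polyC_exp evC => /eqP.
by rewrite scaler_eq0 (negPf one0) orbF expf_eq0 => /andP [_ /eqP].
Qed.

(** The scalar a with x - a nilpotent is unique, and linear in x because nilpotents are closed under
    sums and scalar multiples. *)
Lemma local_functional : exists f : 'Hom(V, F^o),
  f one = 1 /\ forall x, f x = 0 <-> nilpow x.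
Proof.
pose g x := proj1_sig (constructive_indefinite_description _ (local_eigenvalue x)).
have gP x : nilpow (x - g x *: one).
  exact: (proj2_sig (constructive_indefinite_description _ (local_eigenvalue x))).
have gU x a : nilpow (x - a *: one) -> g x = a.
  move=> ha; apply/eqP; rewrite -subr_eq0; apply/eqP; apply: nilpow_scale_one.
  have -> : (g x - a) *: one = (x - a *: one) + (-1) *: (x - g x *: one).
    by rewrite scaleN1r opprB scalerBl [in RHS]addrC addrA subrK.
  by apply: nilpowD => //; apply: nilpowZ.
have [f fE] : exists f : 'Hom(V, F^o), f =1 g.
  apply: linear_functionalP => a x y; apply: gU.
  have -> : a *: x + y - (a * g x + g y) *: one
    = a *: (x - g x *: one) + (y - g y *: one).
    by rewrite scalerBr scalerDl scalerA opprD addrACA.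
  by apply: nilpowD => //; apply: nilpowZ.
exists f; split=> [|x]; rewrite fE.
  by apply: gU; rewrite scale1r subrr; exists 1%N; rewrite /= (jmul0l hJ).
split=> [E|nx]; first by have := gP x; rewrite E scale0r subr0.
by apply: gU; rewrite scale0r subr0.
Qed.
End LocalAlgebra.

(** * Common kernels of functionals *)

Lemma mem_bigcap_lker (F : fieldType) (V W : vectType F) (fs : seq 'Hom(V, W)) x :
  (x \in (\bigcap_(f <- fs) lker f)%VS) = all (fun f : 'Hom(V, W) => f x == 0) fs.
Proof.
by elim: fs => [|f fs IH]; rewrite ?big_nil ?memvf // big_cons memv_cap memv_ker IH.
Qed.

(** Greedy choice: adding a functional that does not vanish on K lowers dim K by at least one, which
    keeps the size bound. *)
Lemma common_kernel (F : fieldType) (V W : vectType F) (Q : 'Hom(V, W) -> Prop) :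
  exists fs : seq 'Hom(V, W), let K := (\bigcap_(f <- fs) lker f)%VS in
    [/\ forall f, f \in fs -> Q f, (size fs + \dim K <= \dim {:V})%N &
        forall f, Q f -> (K <= lker f)%VS].
Proof.
pose K (fs : seq 'Hom(V, W)) := (\bigcap_(f <- fs) lker f)%VS.
suff H n fs : \dim (K fs) = n -> (forall f, f \in fs -> Q f) ->
    (size fs + \dim (K fs) <= \dim {:V})%N ->
    exists fs', [/\ forall f, f \in fs' -> Q f, (size fs' + \dim (K fs') <= \dim {:V})%N &
        forall f, Q f -> (K fs' <= lker f)%VS].
  by apply: (H _ [::] erefl) => //; rewrite /K big_nil.
elim/ltn_ind: n fs => n IH fs dK hQ hd.
have [[f [Qf nf]]|h] := classic (exists f, Q f /\ ~~ (K fs <= lker f)%VS); last first.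
  exists fs; split=> // f Qf; apply/negPn/negP => nf.
  by apply: h; exists f.
have lt : (\dim (K (f :: fs)) < \dim (K fs))%N.
  have sub : (K (f :: fs) <= K fs)%VS by rewrite /K big_cons capvSr.
  rewrite (ltn_leqif (dimv_leqif_eq sub)); apply: contra nf => /eqP <-.
  by rewrite /K big_cons capvSl.
apply: (IH _ _ (f :: fs) erefl); first by rewrite -dK.
  by move=> g; rewrite inE => /orP [/eqP ->|/hQ].
by rewrite /= addSnnS (leq_trans _ hd) // leq_add2l.
Qed.

Lemma iter_comp (T : Type) (g h : T -> T) n y :
  iter n (h \o g) (h y) = h (iter n (g \o h) y).
Proof. by elim: n => //= n ->. Qed.

(** * Spectral functionals *)

Section Nilop.
Variables (F : fieldType) (V : vectType F).
Implicit Types g h : V -> V.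

Lemma nilop_ext g h : g =1 h -> nilop g -> nilop h.
Proof. by move=> E [n hn]; exists n => y; rewrite -(eq_iter E). Qed.

(** (h g)^(n+1) = h (g h)^n g. *)
Lemma nilop_comp g h : h 0 = 0 -> nilop (g \o h) -> nilop (h \o g).
Proof.
by move=> h0 [n hn]; exists n.+1 => y; rewrite iterSr /= iter_comp hn.
Qed.
End Nilop.

Section Global.
Variables (F : closedFieldType) (V : vectType F) (mul : V -> V -> V) (one : V).
Hypotheses (char2 : (2%:R : F) != 0) (hJ : is_jordan_algebra mul).
Hypothesis hone : is_unit_elt mul one.

Local Notation "x ∙ y" := (mul x y) (at level 40, left associativity).
Local Notation U := (quad mul).
Local Notation quad_quad := (quad_quad char2 hJ).

(* The kernel of f is the set Z_w of the header. *)
Definition spectral w (f : 'Hom(V, F^o)) :=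
  f one = 1 /\ forall x, f x = 0 <-> nilop (U w \o U x).

Lemma hom_scale (f : 'Hom(V, F^o)) a x : f (a *: x) = a * f x.
Proof. by rewrite linearZ. Qed.

Lemma spectral_unique w f g : spectral w f -> spectral w g -> f =1 g.
Proof.
move=> [f1 fz] [g1 gz] x.
have /fz /gz : f (x - f x *: one) = 0.
  by rewrite linearB /= hom_scale f1 mulr1 subrr.
by rewrite linearB /= hom_scale g1 mulr1 => /subr0_eq.
Qed.

Lemma spectral_quad w f a : spectral w f -> f (a ∙ a) != 0 ->
  exists2 g, spectral (U a w) g & forall x, g x = f (U a x) / f (a ∙ a).
Proof.
move=> [f1 fz] fa.
have [g gE] : exists g : 'Hom(V, F^o), g =1 (fun x => f (U a x) / f (a ∙ a)).
  apply: linear_functionalP => b x y.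
  by rewrite (quad_linear hJ) linearP /= mulrDl -[b *: f _]/(b * f _) mulrA.
exists g => //; split=> [|x]; rewrite gE.
  by rewrite (quad1r hone) divff.
(* By the fundamental formula both operators are products of U_w, U_a, U_x, U_a, in cyclically
   rotated order. *)
have step1 : nilop (U w \o U (U a x)) <-> nilop (U (U a w) \o U x).
  split=> h.
    apply: (@nilop_ext _ _ (U a \o (U w \o U a \o U x))) => [y /=|].
      by rewrite quad_quad.
    apply: nilop_comp => /=; first by rewrite (quad0r hJ).
    by apply: nilop_ext h => y /=; rewrite quad_quad.
  apply: (@nilop_ext _ _ ((U w \o U a \o U x) \o U a)) => [y /=|].
    by rewrite quad_quad.
  apply: nilop_comp => /=; first by rewrite !(quad0r hJ).
  by apply: nilop_ext h => y /=; rewrite quad_quad.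
rewrite -step1 -fz; split=> [/eqP|->]; last by rewrite mul0r.
by rewrite mulf_eq0 invr_eq0 (negPf fa) orbF => /eqP.
Qed.

Lemma quad_one_add s a x :
  U (one + s *: a) x = x + (2%:R * s) *: (a ∙ x) + s ^+ 2 *: U a x.
Proof.
rewrite /quad !(jmulE hJ) !(jmul1l hone) !(jmul1r hone) scalerBr scalerA -expr2.
rewrite !mulr2n !scalerDr !scalerA -expr2 mulrDl mul1r scalerDl.
by vring.
Qed.

Lemma hom_quad_one_add (f : 'Hom(V, F^o)) s a x :
  f (U (one + s *: a) x) = f x + 2%:R * s * f (a ∙ x) + s ^+ 2 * f (U a x).
Proof.
by rewrite quad_one_add; move: (U a x) => y; rewrite !linearD /= !hom_scale.
Qed.

Definition spectral_null x := forall w f, spectral w f -> f x = 0.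

Lemma spectral_null_mul a x : spectral_null x -> spectral_null (a ∙ x).
Proof.
move=> hx w f hf; have f1 := hf.1.
pose P (s : F) : F := 1 + 2%:R * s * f a + s ^+ 2 * f (a ∙ a).
have fP s : f ((one + s *: a) ∙ (one + s *: a)) = P s.
  by rewrite -(quad1r hone) hom_quad_one_add f1 (jmul1r hone) (quad1r hone).
have key s : P s != 0 -> 2%:R * s * f (a ∙ x) + s ^+ 2 * f (U a x) = 0.
  rewrite -fP => Ps; have [g hg gE] := spectral_quad hf Ps.
  have := hx _ _ hg; rewrite gE => /eqP; rewrite mulf_eq0 invr_eq0 (negPf Ps) orbF.
  by rewrite hom_quad_one_add (hx _ _ hf) add0r => /eqP.
(* A non-root t of [p] has t, P(t) and P(-t) nonzero; subtracting [key] at -t from [key] at t leaves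
   4 t f(ax). *)
pose p : {poly F} := 'X * ((1 + (2%:R * f a) *: 'X + f (a ∙ a) *: 'X^2)
   * (1 - (2%:R * f a) *: 'X + f (a ∙ a) *: 'X^2)).
have p0 : p != 0.
  have nz b c : (1 + b *: 'X + c *: 'X^2 : {poly F}) != 0.
    apply/eqP => /(congr1 (fun q => q.[0])); rewrite !hornerE /= !mulr0 !addr0.
    by move/eqP; rewrite oner_eq0.
  by rewrite !mulf_neq0 ?polyX_eq0 // -scaleNr.
have /closed_nonrootP [t] := p0.
rewrite rootE !hornerE /= !mulf_eq0 !negb_or => /andP [/andP [t0 t1] t2].
have k1 : 2%:R * t * f (a ∙ x) + t ^+ 2 * f (U a x) = 0.
  apply: key; apply: contraNneq t1 => <-; apply/eqP; rewrite /P; ring.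
have k2 : 2%:R * (- t) * f (a ∙ x) + (- t) ^+ 2 * f (U a x) = 0.
  apply: key; apply: contraNneq t2 => <-; apply/eqP; rewrite /P; ring.
have : 2%:R * 2%:R * t * f (a ∙ x) = 0.
  transitivity ((2%:R * t * f (a ∙ x) + t ^+ 2 * f (U a x)) -
     (2%:R * (- t) * f (a ∙ x) + (- t) ^+ 2 * f (U a x))); first by ring.
  by rewrite k1 k2 subrr.
by move/eqP; rewrite !mulf_eq0 (negPf char2) (negPf t0) /= => /eqP.
Qed.
End Global.

(** * Primitive idempotents and their Peirce spaces *)

Section Primitive.
Variables (F : closedFieldType) (V : vectType F) (mul : V -> V -> V) (one : V).
Hypotheses (char2 : (2%:R : F) != 0) (hJ : is_jordan_algebra mul).
Hypothesis hone : is_unit_elt mul one.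

Local Notation "x ∙ y" := (mul x y) (at level 40, left associativity).
Local Notation U := (quad mul).
Local Notation quad_quad := (quad_quad char2 hJ).
Local Notation spectral := (spectral mul one).

(** The Jordan identity at e reads L_e (2 L_e - 1) (L_e - 1) = 0, and U_e = L_e (2 L_e - 1). *)
Lemma mul_quad_idem e y : e ∙ e = e -> e ∙ U e y = U e y.
Proof.
move=> ee; have := mul_mul_operator char2 hJ e e e y.
rewrite /quad !ee !mulr2n !(jmulE hJ).
move: (e ∙ y) => a E.
apply: (sub_eq_trans (esym E)); vring.
Qed.

Lemma quad_mulself x y : U (x ∙ x) y = U x (U x y).
Proof. by rewrite -(quad1r hone) quad_quad (quad1l hone). Qed.

Definition primitive e := forall c, c ∙ c = c -> U e c = c -> c = 0 \/ c = e.

(** Descent on dim U_e V: an idempotent c of U_e V other than 0 and e has U_c V strictly inside U_e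
    V. *)
Lemma primitive_exists (K : {vspace V}) c :
  (forall x y, x \in K -> x ∙ y \in K) -> c ∙ c = c -> c != 0 -> c \in K ->
  exists e, [/\ e ∙ e = e, e != 0, e \in K & primitive e].
Proof.
move=> hK.
have Uself e : e ∙ e = e -> U e e = e by move=> ee; rewrite /quad !ee mulr2n addrK.
pose L e : {linear V -> V} :=
  HB.pack (U e) (GRing.isLinear.Build _ _ _ _ (U e) (quad_linear hJ e)).
have LE e y : linfun (L e) y = U e y by rewrite lfunE.
elim/ltn_ind: {c}(\dim (limg (linfun (L c)))) {-2}c (erefl (\dim (limg (linfun (L c)))))
  => n IH e dn ee e0 eK.
have [pe|npe] := classic (primitive e); first by exists e.
have [c [cc Uc c0 ce]] : exists c, [/\ c ∙ c = c, U e c = c, c != 0 & c != e].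
  apply: NNPP => h; apply: npe => c cc Uc.
  have [|c0] := eqVneq c 0; first by left.
  have [|ce] := eqVneq c e; first by right.
  by case: h; exists c.
apply: (IH _ _ c erefl) => //; last first.
  by rewrite -Uc /quad ee mulr2n memvB ?memvD ?hK.
rewrite -dn.
have sub : (limg (linfun (L c)) <= limg (linfun (L e)))%VS.
  apply/subvP => _ /memv_imgP [y _ ->].
  by rewrite LE -Uc quad_quad -LE memv_img ?memvf.
(* Were the images equal, e = U_c z would give U_c e = e, whereas U_c e = c. *)
rewrite (ltn_leqif (dimv_leqif_eq sub)); apply: contra ce => /eqP E.
have : e \in limg (linfun (L c)) by rewrite E -{1}(Uself e ee) -LE memv_img ?memvf.
case/memv_imgP => z _; rewrite LE => Ez.
have ec : c ∙ e = c by rewrite (jmulC hJ) -{1}Uc mul_quad_idem.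
have E1 : U c e = e by rewrite {1}Ez -quad_mulself cc.
by rewrite -E1 /quad ec cc ec mulr2n addrK.
Qed.

Section PeirceOne.
Variable e : V.
Hypotheses (ee : e ∙ e = e) (e0 : e != 0) (eprim : primitive e).

Let Ulin : {linear V -> V} :=
  HB.pack (U e) (GRing.isLinear.Build _ _ _ _ (U e) (quad_linear hJ e)).
Let A := limg (linfun Ulin).

Let UUe y : U e (U e y) = U e y.
Proof. by rewrite -quad_mulself ee. Qed.

Let memA x : (x \in A) = (U e x == x).
Proof.
apply/idP/eqP => [/memv_imgP [y _]|<-]; first by rewrite lfunE /= => ->.
by have := memv_img (linfun Ulin) (memvf x); rewrite lfunE.
Qed.

Let eA : e \in A.
Proof. by rewrite memA /quad !ee mulr2n addrK. Qed.

Let sqA x : x \in A -> x ∙ x \in A.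
Proof.
rewrite memA => /eqP xA; rewrite memA -(quad1r hone) -{1}xA quad_quad UUe.
by rewrite -quad_quad xA.
Qed.

Let mulA_in x y : x \in A -> y \in A -> x ∙ y \in A.
Proof.
move=> xA yA; have -> : x ∙ y = 2%:R^-1 *: ((x + y) ∙ (x + y) - x ∙ x - y ∙ y).
  apply: (scalerI char2); rewrite scalerA divff // scale1r scaler_nat !(jmulE hJ).
  rewrite (jmulC hJ y x) mulr2n; vring.
by rewrite memvZ // !memvB ?sqA ?memvD.
Qed.

(** The Peirce space U_e V as an algebra of its own with identity e; primitivity of e leaves it no
    idempotents but 0 and e. *)
Let mulA (u v : subvs_of A) : subvs_of A := vsproj A (vsval u ∙ vsval v).

Let val_mulA u v : vsval (mulA u v) = vsval u ∙ vsval v.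
Proof. by rewrite vsprojK // mulA_in // subvsP. Qed.

Let oneA := vsproj A e.

Let val_oneA : vsval oneA = e.
Proof. by rewrite vsprojK. Qed.

Let jordanA : is_jordan_algebra mulA.
Proof.
split; first split.
- by move=> a x y z; apply: subvs_inj; rewrite linearP /= !val_mulA linearP /= !(jmulE hJ).
- by move=> a x y z; apply: subvs_inj; rewrite linearP /= !val_mulA linearP /= !(jmulE hJ).
- by move=> x y; apply: subvs_inj; rewrite !val_mulA (jmulC hJ).
- by move=> x y; apply: subvs_inj; rewrite !val_mulA; case: hJ.
Qed.

Let unitA : is_unit_elt mulA oneA.
Proof.
move=> x; have E : mulA oneA x = x.
  apply: subvs_inj; rewrite val_mulA val_oneA.
  by have := subvsP x; rewrite memA => /eqP <-; rewrite mul_quad_idem.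
by split=> //; rewrite (jmulC jordanA).
Qed.

Let oneA0 : oneA != 0.
Proof. by apply: contra e0 => /eqP E; rewrite -val_oneA E linear0. Qed.

Let localA c : mulA c c = c -> c = 0 \/ c = oneA.
Proof.
move=> cc; have := subvsP c; rewrite memA => /eqP Uc.
case: (@eprim (vsval c)) => //; first by rewrite -val_mulA cc.
  by move=> E; left; apply: subvs_inj; rewrite E linear0.
by move=> E; right; apply: subvs_inj; rewrite E val_oneA.
Qed.

Let nilpowA u : nilpow mulA oneA u <-> nilpow mul one (vsval u).
Proof.
(* Exponents start at 1: the zeroth powers are e and [one]. *)
have E n : vsval (pw mulA oneA u n.+1) = pw mul one (vsval u) n.+1.
  elim: n => [|n IH]; first by rewrite /= (jmul1r unitA) (jmul1r hone).
  by rewrite [pw _ _ _ _]/= val_mulA IH.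
split=> [[n hn]|[n hn]]; exists n.+1.
  by rewrite -E /= hn val_mulA linear0 (jmul0r hJ).
  by apply: subvs_inj; rewrite E [pw _ _ _ _]/= hn (jmul0r hJ) linear0.
Qed.

Lemma spectral_primitive : exists2 f, spectral e f & f e = 1.
Proof.
have [fA [fA1 fAz]] := local_functional char2 jordanA unitA oneA0 localA.
have [f fE] : exists f : 'Hom(V, F^o), f =1 (fun x => fA (vsproj A (U e x))).
  by apply: linear_functionalP => a x y; rewrite (quad_linear hJ) !linearP.
have Ue : U e e = e by rewrite /quad !ee mulr2n addrK.
exists f; last by rewrite fE Ue.
split=> [|x]; first by rewrite fE (quad1r hone) ee.
have xA : U e x \in A by rewrite memA UUe.
rewrite fE fAz nilpowA vsprojK // -(nilop_quad char2 hJ hone).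
have z a : U a 0 = 0 := quad0r hJ a.
(* U_(U_e x) = U_e U_x U_e and U_e U_x are nilpotent together, by cyclic rotation and U_e U_e =
   U_e. *)
split=> h.
  apply: (@nilop_ext _ _ (U e \o (U e \o U x))) => [y /=|]; first by rewrite UUe.
  apply: nilop_comp; first by rewrite /= !z.
  by apply: nilop_ext h => y /=; rewrite quad_quad.
apply: (@nilop_ext _ _ ((U e \o U x) \o U e)) => [y /=|].
  by rewrite quad_quad.
apply: nilop_comp; first by rewrite /= !z.
by apply: nilop_ext h => y /=; rewrite UUe.
Qed.
End PeirceOne.

Lemma spectral_null_nil (K : {vspace V}) x :
  (forall x y, x \in K -> y ∙ x \in K) ->
  (forall x, x \in K -> spectral_null mul one x) ->
  x \in K -> nilpow mul one x.
Proof.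
move=> hK hnull xK; apply: NNPP => nx.
have [p p0 px] := annihilator_exists mul one x.
have [k [q]] := multiplicity_XsubC p 0; rewrite p0 polyC0 subr0 /= => q0 Ep.
(* Exponent k+1, not k, so that even for k = 0 the idempotent c is a multiple of x and lies in K. *)
have px' : ev mul one x ('X^(k.+1) * q) = 0.
  rewrite (_ : _ * _ = p * 'X); first by rewrite (evMX _ hJ) px (jmul0r hJ).
  by rewrite Ep exprSr; ring.
have cop : coprimep ('X^(k.+1)) q.
  by rewrite coprimep_expl // coprimep_sym -['X]subr0 -polyC0 coprimep_XsubC.
have [u [cc hc0 _]] := idempotent_split char2 hJ hone px' cop.
set c := ev mul one x _ in cc hc0.
have c0 : c != 0.
  by apply/eqP => /hc0; rewrite (evXn char2 hJ hone) => h; apply: nx; exists k.+1.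
have cK : c \in K.
  rewrite /c exprSr mulrA (evMX _ hJ) (jmulC hJ); exact: hK.
have hK' y z : y \in K -> y ∙ z \in K by rewrite (jmulC hJ); apply: hK.
have [e [ee e0 eK ep]] := primitive_exists hK' cc c0 cK.
have [f fs fe] := spectral_primitive ee e0 ep.
by move: (hnull _ eK _ _ fs); rewrite fe => /eqP; rewrite oner_eq0.
Qed.
End Primitive.

(** * Two-local maps *)

(** The f_i embed V in F^m with m <= dim V, hence give an isomorphism. Every vector of F^m is then
    the g-coordinate vector of some [D y], so the g-coordinate map is onto, hence injective. *)
Lemma functionals_separating_range (F : fieldType) (V : vectType F) m
    (f g : 'I_m -> 'Hom(V, F^o)) (D : V -> V) :
  (m <= \dim {:V})%N -> (forall x, (forall i, f i x = 0) -> x = 0) ->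
  (forall i x, g i (D x) = f i x) ->
  forall x, (forall i, g i x = 0) -> x = 0.
Proof.
move=> le_m fsep gD x gx.
pose coords (h : 'I_m -> 'Hom(V, F^o)) y : 'rV[F]_m := \row_i h i y.
have lin h : linear (coords h).
  by move=> a u v; apply/rowP => i; rewrite !mxE linearP.
pose L h : {linear V -> 'rV[F]_m} :=
  HB.pack (coords h) (GRing.isLinear.Build _ _ _ _ (coords h) (lin h)).
have LE h y : linfun (L h) y = coords h y by rewrite lfunE.
have kf : lker (linfun (L f)) = 0%VS.
  apply/eqP; rewrite -subv0; apply/subvP => y; rewrite memv_ker LE memv0 => /eqP.
  by move=> /rowP E; apply/eqP/fsep => i; have := E i; rewrite !mxE.
have dm : \dim {:'rV[F]_m} = m by rewrite dimvf /dim /= mul1n.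
have Lf : limg (linfun (L f)) = fullv.
  apply/eqP; rewrite eqEdim subvf /= dm (leq_trans le_m) //.
  by rewrite -(limg_ker_dim (linfun (L f)) fullv) kf capv0 dimv0 add0n.
have Lg : limg (linfun (L g)) = fullv.
  apply/eqP; rewrite eqEsubv subvf -Lf; apply/subvP => _ /memv_imgP [y _ ->].
  rewrite (_ : linfun (L f) y = linfun (L g) (D y)) ?memv_img ?memvf //.
  by rewrite !LE; apply/rowP => i; rewrite !mxE gD.
have dV : \dim {:V} = m.
  by have := limg_ker_dim (linfun (L f)) fullv; rewrite kf capv0 dimv0 Lf dm.
have := limg_ker_dim (linfun (L g)) fullv; rewrite Lg dm capfv dV => E.
have k0 : \dim (lker (linfun (L g))) == 0%N by rewrite -(eqn_add2r m) E.
suff : x \in lker (linfun (L g)) by move: k0; rewrite dimv_eq0 => /eqP ->; rewrite memv0 => /eqP.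
by rewrite memv_ker LE; apply/eqP/rowP => i; rewrite !mxE gx.
Qed.

Lemma bijective_of_linear_inj (F : fieldType) (V : vectType F) (g : V -> V) :
  linear g -> injective g -> bijective g.
Proof.
move=> glin ginj; have surj := linear_inj_surj glin ginj.
pose h y := proj1_sig (constructive_indefinite_description _ (surj y)).
have gh y : g (h y) = y by exact: (proj2_sig (constructive_indefinite_description _ (surj y))).
by exists h => // x; apply: ginj; rewrite gh.
Qed.

Section TwoLocal.
Variables (F : closedFieldType) (V : vectType F) (mul : V -> V -> V) (one : V).
Hypotheses (char2 : (2%:R : F) != 0) (hJ : is_jordan_algebra mul).
Hypotheses (hone : is_unit_elt mul one).

Local Notation "x ∙ y" := (mul x y) (at level 40, left associativity).
Local Notation U := (quad mul).
Local Notation spectral := (spectral mul one).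

Lemma spectral_separating : jsemisimple mul ->
  exists2 fs : seq 'Hom(V, F^o), (size fs <= \dim {:V})%N &
    (forall f, f \in fs -> exists w, spectral w f) /\
    (forall x, (forall f, f \in fs -> f x = 0) -> x = 0).
Proof.
move=> hss; have [fs [hQ hd hK]] := common_kernel (fun f => exists w, spectral w f).
set K := (\bigcap_(f <- fs) lker f)%VS in hd hK.
have KP x : x \in K <-> spectral_null mul one x.
  split=> [xK w f wf|hx].
    by have /subvP /(_ _ xK) := hK f (ex_intro _ w wf); rewrite memv_ker => /eqP.
  by rewrite mem_bigcap_lker; apply/allP => f /hQ [w /hx ->].
have hI x y : x \in K -> y ∙ x \in K.
  by move=> /KP hx; apply/KP; apply: spectral_null_mul.
have K0 : K = 0%VS.
  apply: hss => [x y /[dup] yK /hI ->|x xK]; first by rewrite (jmulC hJ) hI.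
  have [k hk] := spectral_null_nil char2 hJ hone hI (fun x => (KP x).1) xK.
  (* [jpow] counts from x^1, [pw] from x^0. *)
  exists k; have -> : jpow mul x k = pw mul one x k.+1.
    by elim: (k) => [|n /= ->] //=; rewrite (jmul1r hone).
  by rewrite /= hk (jmul0r hJ).
exists fs; first by rewrite (leq_trans _ hd) // leq_addr.
split=> // x hx; apply/eqP; rewrite -memv0 -K0 mem_bigcap_lker.
by apply/allP => f /hx ->.
Qed.

Variable D : V -> V.
Hypothesis hD : two_local_1_automorphism mul one D.

Lemma two_local_quad x y : exists s, [/\ s ∙ s = one, D x = U s x & D y = U s y].
Proof.
have [s [ss -> ->]] := hD x y; exists s; split=> //.
  by rewrite /Umap /quad ss (jmul1l hone).
by rewrite /Umap /quad ss (jmul1l hone).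
Qed.

Lemma symmetry_quad_invol s x : s ∙ s = one -> U s (U s x) = x.
Proof. by move=> ss; rewrite -(quad_mulself char2 hJ hone) ss (quad1l hone). Qed.

Lemma two_local_functional w f : spectral w f ->
  exists g : 'Hom(V, F^o), forall x, g (D x) = f x.
Proof.
move=> hf; have transport s : s ∙ s = one ->
    exists2 g, spectral (U s w) g & forall x, g x = f (U s x).
  move=> ss; have f0 : f (s ∙ s) != 0 by rewrite ss hf.1 oner_eq0.
  have [g hg gE] := spectral_quad char2 hJ hone hf f0.
  by exists g => // x; rewrite gE ss hf.1 divr1.
(* The pair (w, w) fixes [g]; for each x the functional [h] belongs to U_t w = D w = U_s w as well,
   so h = g. *)
have [s [ss Dw _]] := two_local_quad w w.
have [g hg _] := transport s ss; exists g => x.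
have [t [tt Dw' ->]] := two_local_quad w x.
have [h hh hE] := transport t tt.
rewrite -Dw' Dw in hh.
by rewrite (spectral_unique hg hh) hE symmetry_quad_invol.
Qed.

(** U_s fixes 1, so (U_s x)^2 = U_(U_s x) 1 = U_s U_x U_s 1 = U_s (x^2). *)
Lemma two_local_square x : D (x ∙ x) = D x ∙ D x.
Proof.
have [s [ss -> ->]] := two_local_quad (x ∙ x) x.
rewrite -!(quad1r hone) (quad_quad char2 hJ) (quad1r hone s) ss.
by rewrite (quad1r hone).
Qed.

Lemma two_local_automorphism : jsemisimple mul -> is_automorphism mul D.
Proof.
move=> hss; have [fs hsz [fspec fsep]] := spectral_separating hss.
pose f (i : 'I_(size fs)) := nth 0 fs i.
have fsep' x : (forall i, f i x = 0) -> x = 0.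
  by move=> fx; apply: fsep => _ /(nthP 0) [i lt_i <-]; exact: (fx (Ordinal lt_i)).
have /fin_all_exists [g gD] : forall i, exists g : 'Hom(V, F^o), forall x, g (D x) = f i x.
  move=> i; have [w wf] := fspec (f i) (mem_nth 0 (ltn_ord i)).
  exact: two_local_functional wf.
have gsep := functionals_separating_range hsz fsep' gD.
have Dlin a x y : D (a *: x + y) = a *: D x + D y.
  apply: subr0_eq; apply: gsep => i.
  by rewrite linearB linearP /= !gD linearP subrr.
split=> //.
  apply: (bijective_of_linear_inj Dlin) => x y E; apply: subr0_eq; apply: fsep' => i.
  by rewrite linearB /= -!gD E subrr.
have DD u v : D (u + v) = D u + D v by rewrite -[u]scale1r Dlin !scale1r.
(* Products are recovered by linearizing D(x^2) = (D x)^2. *)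
move=> x y; apply: (add_self_inj char2).
have := two_local_square (x + y).
rewrite !(jmulE hJ) !DD !(jmulE hJ) !two_local_square (jmulC hJ y) (jmulC hJ (D y)) => E.
apply: (sub_eq_trans (esym E)); vring.
Qed.
End TwoLocal.

Theorem theorem4p9 (F : closedFieldType) (V : vectType F)
    (mul : V -> V -> V) (one : V)
    (hchar : ~~ (2%N \in [pchar F]))
    (hJ : is_jordan_algebra mul) (hone : is_unit_elt mul one)
    (hss : jsemisimple mul)
    (D : V -> V) (hD : two_local_1_automorphism mul one D) :
  is_automorphism mul D.
Proof.
by apply: (two_local_automorphism _ hJ hone hD hss); rewrite inE in hchar.
Qed.
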